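(* Let $r\ge3$ be an odd integer and $a\ge r+3$ an even integer. The subtraction game $\mathcal{S}(1,a,a+r)$ is ultimately periodic with period $2a+r$ and nim-sequence $(01)^{(r+1)/2}\,2\,(01)^{(a-2)/2}\,2\,(01)^{(r+1)/2}(23)^{(a-r-3)/2}\,2$. Moreover, the subtraction set has expansion $\{1,a,a+r\}\cup\{a+r+2,\,2a+r+1,\,3a+r\}^{*(2a+r)}$.
   Context: For a finite set $S$ of positive integers, the subtraction game $\mathcal{S}(S)$ is played on a single pile: two players alternately remove $s\in S$ coins (at most the pile size); the last mover wins. The nim-value is $\mathcal{G}(n)=\operatorname{mex}\{\mathcal{G}(n-s): s\in S, s\le n\}$. Words of single digits are written by juxtaposition, and $x^m$ denotes $m$-fold repetition of the block $x$ ($x^0$ empty). ''The game is ultimately periodic with period $p$ and nim-sequence $W$'' ($W$ a word of length $p$) means $p$ is the least positive integer with $\mathcal{G}(n+p)=\mathcal{G}(n)$ for all sufficiently large $n$, and there is $n_0\ge0$ such that $\mathcal{G}(n_0+j)$ is the $((j\bmod p)+1)$-st letter of $W$ for all $j\ge0$. The expansion of $S$ is $S^{ex}=\{s\ge1:\mathcal{G}(n+s)\ne\mathcal{G}(n)\ \forall n\ge0\}$; ''has expansion $T$'' means $S^{ex}=T$. For a set $X$ and $p\ge1$, $X^{*p}=\{x+mp:x\in X,m\ge0\}$.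
   Formalization: For a = r+3 the word is the cube of (01)^{(r+1)/2} 2, so 2a+r is not the least period (e.g. S(1,6,9) has period 5); there 2a+r is proved to be a period with the stated nim-sequence, and the least period is r+2. All other claims are unchanged. *)

(* Defs.v *)
From mathcomp Require Import all_boot.

Set Implicit Arguments.
Unset Strict Implicit.
Unset Printing Implicit Defensive.

Lemma mex_exists (s : seq nat) : exists m, m \notin s.
Proof.
exists (foldr maxn 0 s).+1; apply/negP => hm.
suff: forall x, x \in s -> x <= foldr maxn 0 s by move/(_ _ hm); rewrite ltnn.
elim: s {hm} => //= y s IHs x; rewrite inE leq_max => /orP[/eqP->|/IHs->].
  by rewrite leqnn.
by rewrite orbT.
Qed.

Definition mex (s : seq nat) : nat := ex_minn (mex_exists s).

(* A finite set S of positive integers is given by a list of its elements;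
   the order and multiplicity of the entries are irrelevant.
   [nim_prefix S n] lists the nim-values of the piles 0, ..., n - 1; the
   recursive equation for the nim-value is [nim_valueE] below. *)
Fixpoint nim_prefix (S : seq nat) (n : nat) : seq nat :=
  if n is k.+1 then
    let g := nim_prefix S k in
    rcons g (mex [seq nth 0 g (k - s) | s <- S & s <= k])
  else [::].

Definition nim_value (S : seq nat) (n : nat) : nat :=
  nth 0 (nim_prefix S n.+1) n.

Lemma size_nim_prefix S n : size (nim_prefix S n) = n.
Proof. by elim: n => //= n IHn; rewrite size_rcons IHn. Qed.

Lemma nth_nim_prefix S n i : i < n -> nth 0 (nim_prefix S n) i = nim_value S i.
Proof.
elim: n => // n IHn; rewrite ltnS leq_eqVlt => /orP[/eqP->//|lt_in].
by rewrite /= nth_rcons size_nim_prefix lt_in IHn.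
Qed.

Lemma nim_valueE S n : {in S, forall s, 0 < s} ->
  nim_value S n = mex [seq nim_value S (n - s) | s <- S & s <= n].
Proof.
move=> S_gt0; rewrite /nim_value /= nth_rcons size_nim_prefix ltnn eqxx.
congr mex; apply/eq_in_map => s; rewrite mem_filter => /andP[le_sn /S_gt0 s_gt0].
by rewrite nth_nim_prefix // -subn_gt0 subKn.
Qed.

Definition ultimate_period (f : nat -> nat) (p : nat) : Prop :=
  0 < p /\ exists N, forall n, N <= n -> f (n + p) = f n.

Definition least_ultimate_period (f : nat -> nat) (p : nat) : Prop :=
  ultimate_period f p /\ forall q, ultimate_period f q -> p <= q.

Definition ultimately_repeats (f : nat -> nat) (W : seq nat) : Prop :=
  exists n0, forall j, f (n0 + j) = nth 0 W (j %% size W).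

Definition ultimately_periodic_with
    (f : nat -> nat) (p : nat) (W : seq nat) : Prop :=
  [/\ size W = p, least_ultimate_period f p & ultimately_repeats f W].

Definition word_pow (x : seq nat) (m : nat) : seq nat := flatten (nseq m x).

Definition expansion (S : seq nat) (s : nat) : Prop :=
  1 <= s /\ forall n, nim_value S (n + s) <> nim_value S n.

Definition has_expansion (S : seq nat) (T : nat -> Prop) : Prop :=
  forall s, expansion S s <-> T s.

(* The set X^{*p} of all x + m p with x in X and m >= 0. *)
Definition star (X : seq nat) (p t : nat) : Prop :=
  exists x m, x \in X /\ t = x + m * p.

Definition nim_word (r a : nat) : seq nat :=
  word_pow [:: 0; 1] (r + 1)./2 ++ [:: 2]
  ++ word_pow [:: 0; 1] (a - 2)./2 ++ [:: 2]
  ++ word_pow [:: 0; 1] (r + 1)./2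
  ++ word_pow [:: 2; 3] (a - r - 3)./2 ++ [:: 2].

(* Main.v *)
Require Import Defs.
From mathcomp Require Import all_boot.
From HB Require Import structures.
From mathcomp Require Import zify.

(* With p = 2a + r, the nim-sequence is
     (01)^(a/2) 2 (01)^((r-1)/2) (23)^((a-r-1)/2) 2
   on [0, 2a), followed by the repeated word, and it satisfies
   g(n + p) = g(n) for all n >= a + r + 2. Both the mex recursion and the
   inequalities g(n + s) <> g(n) for s in {1, a, a + r, a + r + 2} therefore
   reduce to finitely many affine pieces of an initial segment.

   The starred elements are congruent to a + r + 2, 1 and a modulo p. Conversely,
   let c = s mod p be different from 0, 1, a, a + r, a + r + 2. If c = a - 2 or
   c = p - 1 (and also if c = a + r but s > a + r), then g(s) = g(0) = 0.
   Otherwise c or p - c is a difference of two zeros of the periodic part lying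
   in the second (01)-block, or in the second and third ones.

   A period q < p moves the 3s of the word, which form one progression of step
   2, to 3s; the last one forces q to reach the next copy of the word, and then
   the first one lands in a gap. For a = r + 3 there are no 3s, and the gaps
   between the 2s give the least period r + 2. *)

Set Implicit Arguments.
Unset Strict Implicit.
Unset Printing Implicit Defensive.

(* The nim-values of the piles 0, ..., 5a + 2r; the last branch is a junk value
   beyond that bound. It is locked because conversion between two instances,
   as attempted by [done], explores exponentially many branches. *)
HB.lock Definition profile (r a n : nat) : nat :=
  if n < a then nat_of_bool (odd n)
  else if n < a + 1 then 2
  else if n < a + r then nat_of_bool (~~ odd n)
  else if n < 2 * a then 2 + ~~ odd n
  else if n < 2 * a + r + 1 then nat_of_bool (odd n)
  else if n < 2 * a + r + 2 then 2
  else if n < 3 * a + r then nat_of_bool (~~ odd n)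
  else if n < 3 * a + r + 1 then 2
  else if n < 3 * a + 2 * r + 2 then nat_of_bool (odd n)
  else if n < 4 * a + r then 2 + odd n
  else if n < 4 * a + 2 * r + 1 then nat_of_bool (~~ odd n)
  else if n < 4 * a + 2 * r + 2 then 2
  else if n < 5 * a + 2 * r then nat_of_bool (odd n)
  else 2.

(** The cut is at [2 * a] because the repeated word is read from there. *)
Definition nim_form (r a n : nat) : nat :=
  profile r a (if n < 2 * a then n else 2 * a + (n - 2 * a) %% (2 * a + r)).

Ltac profile_cases n :=
  do ?[case: (ltnP n) => ?]; try (exfalso; lia).

(** * Mex and indexing of words *)

Lemma mex_eq (l : seq nat) v :
  v \notin l -> (forall u, u < v -> u \in l) -> mex l = v.
Proof.
move=> v_notin lt_in; rewrite /mex; case: ex_minnP => m m_notin m_min.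
apply/eqP; rewrite eqn_leq m_min // leqNgt /=.
by apply: contra m_notin => /lt_in.
Qed.

Lemma size_word_pow x y m : size (word_pow [:: x; y] m) = 2 * m.
Proof. by elim: m => //= m; rewrite /word_pow /= => ->; rewrite mulnS. Qed.

Lemma nth_word_pow x y m i :
  nth 0 (word_pow [:: x; y] m) i = if i < 2 * m then (if odd i then y else x) else 0.
Proof.
elim: m i => [|m IHm] i; first by rewrite muln0 nth_nil.
rewrite mulnS; case: i => [|[|i]] //.
by rewrite [LHS]IHm /= negbK.
Qed.

(** * Periodicity of the closed form *)

Section NimForm.
Variables (r a : nat).
Hypotheses (r_ge3 : 3 <= r) (r_odd : odd r).
Hypotheses (a_ge : r + 3 <= a) (a_even : ~~ odd a).
Local Notation p := (2 * a + r).
Local Notation h := (profile r a).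
Local Notation g := (nim_form r a).

(** The lower bound is sharp: the value is 3 at [a + r + 1] and 1 one period later. *)
Lemma profile_period n : a + r + 2 <= n <= 3 * a + r -> h (n + p) = h n.
Proof.
move=> n_bnd; rewrite profile.unlock.
profile_cases n; profile_cases (n + (2 * a + r)); lia.
Qed.

Lemma nim_form_profile n : n <= 5 * a + 2 * r -> g n = h n.
Proof.
rewrite /nim_form; case: ltnP => [|n_ge n_le] //.
have [n_lt|n_ge'] := ltnP (n - 2 * a) p.
  by rewrite modn_small // subnKC.
have ->: n - 2 * a = n - 2 * a - p + p by rewrite subnK.
rewrite modnDr modn_small; last lia.
rewrite -profile_period; last lia.
by congr profile; lia.
Qed.

Lemma nim_form_period n : a + r + 2 <= n -> g (n + p) = g n.
Proof.
move=> n_ge; have [n_lt|n_ge'] := ltnP n (2 * a).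
  have n_le : n + p <= 5 * a + 2 * r by lia.
  rewrite !nim_form_profile //; last lia.
  by apply: profile_period; lia.
rewrite /nim_form.
have -> : (n + p < 2 * a) = false by lia.
have -> : (n < 2 * a) = false by lia.
by rewrite -addnBAC // modnDr.
Qed.

Lemma nim_form_periodM n m : a + r + 2 <= n -> g (n + m * p) = g n.
Proof.
move=> n_ge; elim: m => [|m IHm]; first by rewrite addn0.
rewrite mulSn [p + _]addnC addnA nim_form_period //.
exact: leq_trans n_ge (leq_addr _ _).
Qed.

(** * Shifts that change every value *)

Lemma profile_shift_neq s n : s \in [:: 1; a; a + r; a + r + 2] ->
  n < 3 * a + 2 * r + 2 -> h (n + s) <> h n.
Proof.
rewrite !inE => /or4P[] /eqP-> n_lt; rewrite profile.unlock; profile_cases n;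
 match goal with |- context [?x < a] => profile_cases x end; lia.
Qed.

Lemma nim_form_neq s n : s \in [:: 1; a; a + r; a + r + 2] -> g (n + s) <> g n.
Proof.
move=> s_in; elim/ltn_ind: n => n IHn.
(* The bound is [p + (a + r + 2)]: from there on [n] descends by [p]; below it, [r + 3 <= a] keeps
   [n + s] inside [profile]. *)
have [n_lt|n_ge] := ltnP n (3 * a + 2 * r + 2).
  have n_s_le : n + s <= 5 * a + 2 * r by move: s_in; rewrite !inE; lia.
  rewrite !nim_form_profile //; last lia.
  exact: profile_shift_neq.
have -> : n = n - p + p by lia.
rewrite addnAC !nim_form_period; [|lia|lia].
by apply: IHn; lia.
Qed.

(** * The mex recursion *)

Definition is_option (f : nat -> nat) n u :=
  [|| (0 < n) && (f (n - 1) == u), (a <= n) && (f (n - a) == u)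
    | (a + r <= n) && (f (n - (a + r)) == u)].

Lemma profile_option n u : n < 4 * a + 3 * r + 2 -> u < h n -> is_option h n u.
Proof.
move=> n_lt; rewrite /is_option profile.unlock => u_lt; apply/orP; move: u_lt.
case: u => [|[|[|u]]]; profile_cases n => u_lt;
  first [left; profile_cases (n - 1); lia
        |right; profile_cases (n - a); profile_cases (n - (a + r)); lia].
Qed.

Lemma nim_form_option n u : u < g n -> is_option g n u.
Proof.
(* The bound is [p + (a + r) + (a + r + 2)], so beyond it even [n - p - (a + r)] is in the periodic
   range. *)
elim/ltn_ind: n => n IHn; have [n_lt|n_ge] := ltnP n (4 * a + 3 * r + 2).
  have n_le : n <= 5 * a + 2 * r by lia.
  rewrite /is_option !nim_form_profile; try lia.
  exact: profile_option.
have En : n = n - p + p by lia.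
rewrite [in g n]En nim_form_period; last lia.
move=> /IHn -/(_ ltac:(lia)); rewrite /is_option => Hu.
have E s : s \in [:: 1; a; a + r] -> g (n - s) = g (n - p - s).
  rewrite !inE => s_in.
  by rewrite -[RHS]nim_form_period; [congr nim_form; lia|lia].
by rewrite !E ?inE ?eqxx ?orbT //; move: Hu; lia.
Qed.

Lemma nim_value_form n : nim_value [:: 1; a; a + r] n = g n.
Proof.
elim/ltn_ind: n => n IHn; rewrite nim_valueE; last first.
  by move=> s; rewrite !inE; lia.
have -> : [seq nim_value [:: 1; a; a + r] (n - s) | s <- [:: 1; a; a + r] & s <= n]
    = [seq g (n - s) | s <- [:: 1; a; a + r] & s <= n].
  apply/eq_in_map => s; rewrite mem_filter !inE => s_in.
  by apply: IHn; lia.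
apply: mex_eq => [|u /nim_form_option].
  apply/mapP => -[s]; rewrite mem_filter => /andP[s_le s_in] Es.
  apply: (@nim_form_neq s (n - s)); last by rewrite subnK.
  by move: s_in; rewrite !inE => /or3P[]->; rewrite ?orbT.
by case/or3P=> /andP[s_le /eqP <-]; apply/map_f;
  rewrite mem_filter s_le !inE eqxx ?orbT.
Qed.

(** * The expansion *)

Lemma profile_shift_eq d :
    (~~ odd d) && (2 <= d <= a - 4) || odd d && (3 <= d <= a + r - 2) ->
  exists x, [/\ 2 * a <= x, x + d <= 5 * a + 2 * r & h (x + d) = h x].
Proof.
case/orP=> /andP[d_odd d_bnd].
  exists (2 * a + r + 2); split; [lia|lia|].
  rewrite profile.unlock; profile_cases (2 * a + r + 2).
  profile_cases (2 * a + r + 2 + d); lia.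
(* For large [d] the first zero of the second (01)-block pairs with a zero of the third; for small
   [d] the first zero of the third pairs with one of the second. *)
have [d_ge|d_lt] := leqP (a - 1) d.
  exists (2 * a + r + 2); split; [lia|lia|].
  rewrite profile.unlock; profile_cases (2 * a + r + 2).
  profile_cases (2 * a + r + 2 + d); lia.
exists (3 * a + r + 1 - d); split; [lia|lia|].
rewrite subnK; last lia.
rewrite profile.unlock; profile_cases (3 * a + r + 1 - d).
profile_cases (3 * a + r + 1); lia.
Qed.

Lemma nim_form_shift_eq c : c < p ->
    c \notin [:: 1; a - 2; a; a + r; a + r + 2; p - 1] ->
  exists2 n, a + r + 2 <= n & g (n + c) = g n.
Proof.
rewrite !inE !negb_or => c_lt c_notin.
have [->|c_gt0] := posnP c; first by exists (2 * a); [lia|rewrite addn0].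
pose good d := (~~ odd d) && (2 <= d <= a - 4) || odd d && (3 <= d <= a + r - 2).
have : good c || good (p - c).
  rewrite /good (_ : odd (p - c) = ~~ odd c); last lia.
  by case c_odd: (odd c) => /=; lia.
case/orP=> /profile_shift_eq.
  case=> x [x_ge x_le Ex]; exists x; first lia.
  by rewrite !nim_form_profile //; lia.
(* Zeros at distance [p - c] become zeros at distance [c] once the lower one moves up by [p]. *)
case=> x [x_ge x_le Ex]; exists (x + (p - c)); first lia.
have -> : x + (p - c) + c = x + p by lia.
rewrite nim_form_period; last lia.
by rewrite !nim_form_profile //; lia.
Qed.

Lemma nim_form_star_neq x m n : x \in [:: a + r + 2; 2 * a + r + 1; 3 * a + r] ->
  g (n + (x + m * p)) <> g n.
Proof.
move=> x_in.
have x_bnd : a + r + 2 <= x <= 3 * a + r by move: x_in; rewrite !inE; lia.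
rewrite addnA nim_form_periodM; last lia.
move: x_in; rewrite inE => /orP[/eqP->|x_in].
  by apply: nim_form_neq; rewrite !inE eqxx !orbT.
pose s := x - p.
have s_in : s \in [:: 1; a; a + r; a + r + 2].
  by rewrite /s; move: x_in; rewrite !inE => /orP[] /eqP->; lia.
have Ex : x = s + p by rewrite /s; move: x_in; rewrite !inE; lia.
have [n_s_lt|n_s_ge] := ltnP (n + s) (a + r + 2); last first.
  by rewrite Ex addnA nim_form_period //; apply: nim_form_neq.
have x_le : p + 1 <= x by move: x_in; rewrite !inE; lia.
rewrite !nim_form_profile; try lia.
have n_lt : n + x < 3 * a + 2 * r + 2 by lia.
move: x_in n_lt x_le {s s_in Ex n_s_lt x_bnd}; rewrite !inE.
case/orP=> /eqP-> n_lt x_le; rewrite profile.unlock; profile_cases n;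
  match goal with |- context [?x < a] => profile_cases x end; lia.
Qed.

(** These are last zeros of (01)-blocks; since [g 0 = 0], they exclude the three residues for every
    [s >= p]. *)
Lemma nim_form_zero c : c \in [:: a - 2; a + r; p - 1] -> g (c + p) = 0.
Proof.
rewrite !inE => c_in; rewrite nim_form_profile; last lia.
by case/or3P: c_in => /eqP->; rewrite profile.unlock;
  match goal with |- context [?x < a] => profile_cases x end; lia.
Qed.

Lemma nim_form_expansion s : 1 <= s -> (forall n, g (n + s) <> g n) ->
  s \in [:: 1; a; a + r] \/ star [:: a + r + 2; 2 * a + r + 1; 3 * a + r] p s.
Proof.
move=> s_gt0 s_neq; pose c := s %% p; pose m := s %/ p.
have p_gt0 : 0 < p by lia.
have Es : s = c + m * p by rewrite /c /m addnC -divn_eq.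
have c_lt : c < p by rewrite ltn_mod.
have g0 : g 0 = 0.
  by rewrite nim_form_profile // profile.unlock; profile_cases 0.
have zero_neq k : m = k.+1 -> c \notin [:: a - 2; a + r; p - 1].
  move=> Em; apply/negP => c_in; apply: (s_neq 0).
  rewrite add0n Es Em mulSn addnA nim_form_periodM; last lia.
  by rewrite nim_form_zero.
have [c_in|/(nim_form_shift_eq c_lt)[n n_ge En]] :=
  boolP (c \in [:: 1; a - 2; a; a + r; a + r + 2; p - 1]); last first.
  case: (s_neq n); rewrite Es addnA nim_form_periodM //.
  exact: leq_trans n_ge (leq_addr _ _).
case Em: m zero_neq => [|k] zero_neq; last first.
  have {zero_neq} := zero_neq k erefl.
  move: c_in; rewrite !inE => c_in c_notin.
  have [Ec|[Ec|Ec]] : c = 1 \/ c = a \/ c = a + r + 2 by lia.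
  (* One of the [k + 1] periods goes into the base element: [1 + p] here, [a + p] in the next
     case. *)
  - right; exists (2 * a + r + 1), k.
    by rewrite !inE eqxx orbT Es Em Ec; split=> //; lia.
  - right; exists (3 * a + r), k.
    by rewrite !inE eqxx !orbT Es Em Ec; split=> //; lia.
  - by right; exists (a + r + 2), k.+1; rewrite !inE eqxx Es Em Ec.
have {}Es : s = c by rewrite Es Em addn0.
move: c_in; rewrite -Es !inE => s_in.
have [s_S|[s_x|s_0]] : [|| s == 1, s == a | s == a + r] \/ s = a + r + 2 \/
    (s == a - 2) || (s == p - 1) by lia.
- by left.
- by right; exists (a + r + 2), 0; rewrite inE eqxx addn0.
case: (s_neq 0); rewrite g0 nim_form_profile; last lia.
by case/orP: s_0 => /eqP->; rewrite profile.unlock;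
  match goal with |- context [?x < a] => profile_cases x end; lia.
Qed.

Lemma has_expansion_nim_value : has_expansion [:: 1; a; a + r]
  (fun t => t \in [:: 1; a; a + r] \/
     star [:: a + r + 2; 2 * a + r + 1; 3 * a + r] p t).
Proof.
move=> s; split=> [[s_gt0 s_neq]|s_T].
  by apply: nim_form_expansion => // n; rewrite -!nim_value_form.
case: s_T => [s_in|[x [m [x_in ->]]]].
  split; first by move: s_in; rewrite !inE; lia.
  move=> n; rewrite !nim_value_form; apply: nim_form_neq.
  by move: s_in; rewrite !inE => /or3P[]->; rewrite ?orbT.
split; first by move: x_in; rewrite !inE; lia.
by move=> n; rewrite !nim_value_form; apply: nim_form_star_neq.
Qed.

(** * The repeated word *)

Lemma size_nim_word : size (nim_word r a) = p.
Proof.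
by rewrite /nim_word !size_cat !size_word_pow /=; lia.
Qed.

Lemma nth_nim_word j : j < p -> nth 0 (nim_word r a) j = h (2 * a + j).
Proof.
move=> j_lt; rewrite /nim_word !nth_cat !nth_word_pow !size_word_pow !nth_seq1 /=.
have -> : 2 * (r + 1)./2 = r + 1 by lia.
have -> : 2 * (a - 2)./2 = a - 2 by lia.
have -> : 2 * (a - r - 3)./2 = a - r - 3 by lia.
rewrite profile.unlock; profile_cases (2 * a + j);
  do ?[case: ltnP => ? | case: eqP => ? | case: ifP => ?]; lia.
Qed.

Lemma ultimately_repeats_nim_word :
  ultimately_repeats (nim_value [:: 1; a; a + r]) (nim_word r a).
Proof.
exists (2 * a) => j; rewrite nim_value_form size_nim_word nth_nim_word; last first.
  by rewrite ltn_mod; lia.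
by rewrite /nim_form ltnNge leq_addr addKn.
Qed.

(** * The least period *)

Lemma ultimate_period_nim_value : ultimate_period (nim_value [:: 1; a; a + r]) p.
Proof.
split; first lia.
by exists (a + r + 2) => n n_ge; rewrite !nim_value_form nim_form_period.
Qed.

(** Moving [n] up by [N] periods passes the threshold [N] of [q]. *)
Lemma nim_form_ultimate_period q n :
  ultimate_period (nim_value [:: 1; a; a + r]) q ->
  a + r + 2 <= n -> g (n + q) = g n.
Proof.
case=> _ [N q_per] n_ge.
rewrite -(nim_form_periodM N n_ge) -(@nim_form_periodM (n + q) N); last first.
  exact: leq_trans n_ge (leq_addr _ _).
rewrite addnAC -!nim_value_form; apply: q_per.
by rewrite (leq_trans _ (leq_addl _ _)) // leq_pmulr //; lia.
Qed.

(** The window stops just before [(a + r + 3) + p], where the 3s can next begin. *)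
Lemma nim_form_eq3 n : a + r + 2 <= n < 3 * a + 2 * r + 3 -> g n = 3 ->
  n <= 2 * a - 2.
Proof.
move=> n_bnd; rewrite nim_form_profile; last lia.
rewrite profile.unlock; profile_cases n; lia.
Qed.

Lemma least_period_generic : a <> r + 3 ->
  least_ultimate_period (nim_value [:: 1; a; a + r]) p.
Proof.
move=> a_neq; split=> [|q q_per]; first exact: ultimate_period_nim_value.
rewrite leqNgt; apply/negP => q_lt; have q_gt0 := q_per.1.
have g3 n : n \in [:: a + r + 3; 2 * a - 2] -> g n = 3.
  rewrite !inE => n_in; rewrite nim_form_profile; last lia.
  by rewrite profile.unlock; profile_cases n; lia.
(* This is the distance from the last 3, at [2 * a - 2], to the first 3 of the next copy. *)
have q_ge : a + 2 * r + 5 <= q.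
  have g3_last : g (2 * a - 2 + q) = 3.
    by rewrite nim_form_ultimate_period ?g3 ?inE ?eqxx ?orbT //; lia.
  rewrite leqNgt; apply/negP => q_small.
  by have := @nim_form_eq3 (2 * a - 2 + q) ltac:(lia) g3_last; lia.
have g3_first : g (a + r + 3 + q) = 3.
  by rewrite nim_form_ultimate_period ?g3 ?inE ?eqxx //; lia.
by have := @nim_form_eq3 (a + r + 3 + q) ltac:(lia) g3_first; lia.
Qed.

Lemma least_period_special : a = r + 3 ->
  least_ultimate_period (nim_value [:: 1; a; a + r]) (r + 2).
Proof.
move=> Ea; split=> [|q q_per].
  split; first lia.
  exists (a + r + 2) => n n_ge; rewrite !nim_value_form.
  elim/ltn_ind: n n_ge => n IHn n_ge.
  have [n_lt|n_ge'] := ltnP n (3 * a + 2 * r + 2).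
    rewrite !nim_form_profile; try lia.
    by rewrite profile.unlock; profile_cases n; profile_cases (n + (r + 2)); lia.
  have -> : n = n - p + p by lia.
  by rewrite addnAC !nim_form_period ?IHn //; lia.
rewrite leqNgt; apply/negP => q_lt; have q_gt0 := q_per.1.
(* The value 2 at [2 * a - 1] is followed by [r + 1] values 0 or 1. *)
have := @nim_form_ultimate_period q (2 * a - 1) q_per ltac:(lia).
rewrite !nim_form_profile; try lia.
rewrite profile.unlock; profile_cases (2 * a - 1);
  profile_cases (2 * a - 1 + q); lia.
Qed.

End NimForm.

(* For a = r + 3 the word [nim_word r a] is the cube of (01)^((r+1)/2) 2, so
   2a + r = 3(r + 2) is a period but not the least one, which is r + 2. *)
Theorem theorem3p6 (r a : nat) :
  3 <= r -> odd r -> r + 3 <= a -> ~~ odd a ->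
  [/\ a <> r + 3 ->
        ultimately_periodic_with (nim_value [:: 1; a; a + r])
          (2 * a + r) (nim_word r a),
      a = r + 3 ->
        [/\ size (nim_word r a) = 2 * a + r,
            ultimate_period (nim_value [:: 1; a; a + r]) (2 * a + r),
            ultimately_repeats (nim_value [:: 1; a; a + r]) (nim_word r a)
          & least_ultimate_period (nim_value [:: 1; a; a + r]) (r + 2)]
    & has_expansion [:: 1; a; a + r]
        (fun t => t \in [:: 1; a; a + r] \/
           star [:: a + r + 2; 2 * a + r + 1; 3 * a + r] (2 * a + r) t)].
Proof.
move=> r_ge3 r_odd a_ge a_even; split=> [a_neq|Ea|]; last first.
- exact: has_expansion_nim_value.
- split; [exact: size_nim_word | exact: ultimate_period_nim_value
         | exact: ultimately_repeats_nim_word | exact: least_period_special].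
- split; [exact: size_nim_word | exact: least_period_generic
         | exact: ultimately_repeats_nim_word].
Qed.
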